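(* Let $\sigma_1,\sigma_2\in\mathcal{P}_c^+$ and set $\nu=\Psi(\sigma_1,\sigma_2)$. Then the $R$-transforms of $ZZ^*$ and of $Z^*Z$ in the noncommutative probability space $(\mathbb{C}\langle Z,Z^*\rangle,\nu)$ are given by $$R_{ZZ^*}(z)=R_{\mathbb{B}(\sigma_1)}\bigl(z(1+M_{\mathbb{B}(\sigma_2)}(z))\bigr),\qquad R_{Z^*Z}(z)=R_{\mathbb{B}(\sigma_2)}\bigl(z(1+M_{\mathbb{B}(\sigma_1)}(z))\bigr).$$
   Context: $\mathcal{P}_c$ (resp. $\mathcal{P}_c^+$) is the set of compactly supported Borel probability measures on $\mathbb{R}$ (resp. on $[0,\infty)$). One-variable series: for an element $a$ of a noncommutative probability space $(\mathcal{A},\varphi)$ (unital complex algebra with linear $\varphi$, $\varphi(1)=1$), $M_a(z)=\sum_{n\ge1}\varphi(a^n)z^n$, $\eta_a=M_a/(1+M_a)$, and $R_a\in\mathbb{C}[[z]]$ is the unique series with zero constant term satisfying $R_a(z(1+M_a(z)))=M_a(z)$ (formal power series). For $\sigma\in\mathcal{P}_c$ the series $M_\sigma,\eta_\sigma,R_\sigma$ are defined the same way from the moments $\int t^n\,d\sigma(t)$. For $\sigma\in\mathcal{P}_c$, $\mathbb{B}(\sigma)\in\mathcal{P}_c$ is the unique measure with $R_{\mathbb{B}(\sigma)}=\eta_\sigma$ (its existence is known). $*$-distributions: $\mathbb{C}\langle Z,Z^*\rangle$ is the algebra of complex polynomials in two non-commuting variables; $\mathcal{W}^+=\bigsqcup_{n\ge1}\{1,*\}^n$;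 for $w=(\ell_1,\dots,\ell_n)$ let $|w|=n$, $Z^w=Z^{\ell_1}\cdots Z^{\ell_n}$, and likewise $a^w$, $z^w$ (with $z,z^*$ non-commuting formal indeterminates). The $*$-distribution of an element $a$ of a $C^*$-probability space $(\mathcal{A},\varphi)$ (unital $C^*$-algebra with positive linear $\varphi$, $\varphi(1)=1$, not assumed tracial) is the linear functional $\mu$ on $\mathbb{C}\langle Z,Z^*\rangle$ with $\mu(1)=1$, $\mu(Z^w)=\varphi(a^w)$; $\mathcal{D}_c(1,* )$ is the set of all of these. For $\mu\in\mathcal{D}_c(1,* )$: $M_\mu=\sum_{w}\mu(Z^w)z^w$; $\eta_\mu=M_\mu(1+M_\mu)^{-1}$; $R_\mu$ is the unique formal series with zero constant term such that for $|w|=n$, $\mu(Z^w)=\sum_{\pi\in NC(n)}\prod_{B\in\pi}\mathrm{Cf}_{w|B}(R_\mu)$, where $NC(n)$ is the set of non-crossing partitions of $\{1,\dots,n\}$, $\mathrm{Cf}_v$ is the coefficient of $z^v$, and $w|B$ is the subword of $w$ with positions in $B$. $\mu$ is $\eta$-diagonal (resp. $R$-diagonal) if $\mathrm{Cf}_w(\eta_\mu)=0$ (resp. $\mathrm{Cf}_w(R_\mu)=0$) for all $w$ not of the form $(1,* )^m$ or $( *,1)^m$, $m\ge1$. Definition of $\Psi$: for $\sigma_1,\sigma_2\in\mathcal{P}_c^+$ there is a unique $\eta$-diagonal $\mu=\Phi(\sigma_1,\sigma_2)\in\mathcal{D}_c(1,* )$ with $\mu((ZZ^* )^n)=\int t^n\,d\sigma_1(t)$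 and $\mu((Z^*Z)^n)=\int t^n\,d\sigma_2(t)$ for all $n\in\mathbb{N}$; then $\Psi(\sigma_1,\sigma_2)$ is the unique $\nu\in\mathcal{D}_c(1,* )$ with $R_\nu=\eta_\mu$ (it exists, is $R$-diagonal, and is infinitely divisible with respect to free additive convolution). *)

(* Defs.v *)
From HB Require Import structures.
From mathcomp Require Import all_boot all_order all_algebra.
From mathcomp Require Import complex monalg.
From mathcomp Require Import all_classical all_reals all_analysis.

Set Implicit Arguments.
Unset Strict Implicit.
Unset Printing Implicit Defensive.
Import Order.TTheory GRing.Theory Num.Theory.
Import numFieldNormedType.Exports.
Local Open Scope ring_scope.

Section FixedPoint.
Variables (K : nmodType) (T : Type) (sz : T -> nat).
Variable F : (T -> K) -> T -> K.
Hypothesis F_local : forall r s x,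
  (forall y, (sz y < sz x)%N -> r y = s y) -> F r x = F s x.

Lemma local_fixpoint : exists r : T -> K, forall x, r x = F r x.
Proof.
pose s k := iter k F (fun=> 0).
have stab k l x : (sz x < k)%N -> (sz x < l)%N -> s k x = s l x.
  elim: k l x => [//|k IHk] [//|l] x xk xl /=.
  by apply: F_local => y yx; apply: IHk; apply: leq_trans yx _.
exists (fun x => s (sz x).+1 x) => x /=.
by apply: F_local => y yx; exact: (esym (stab (sz y).+1 (sz x) y (leqnn _) yx)).
Qed.

Lemma local_fixpoint_uniq (r s : T -> K) :
  (forall x, r x = F r x) -> (forall x, s x = F s x) -> r = s.
Proof.
move=> Fr Fs; apply/funext => x.
have [n] := ubnP (sz x); elim: n x => [//|n IHn] x xn.
by rewrite Fr Fs; apply: F_local => y yx; apply: IHn; apply: leq_trans yx _.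
Qed.

End FixedPoint.

(* A formal power series in one variable over K is its coefficient sequence
   nat -> K.  Its product is fps_mul: beware that the ring product of the type
   nat -> K is the pointwise one. *)
Section OneVariable.
Variable K : comNzRingType.
Implicit Types f g h M : nat -> K.

Definition fps_one : nat -> K := fun n => (n == 0%N)%:R.

Definition fps_mul f g : nat -> K :=
  fun n => \sum_(i < n.+1) f i * g (n - i)%N.

Definition fps_exp f k : nat -> K := iter k (fps_mul f) fps_one.

(* f(g(z)), for g with zero constant term, so that the coefficient of z^n in
   g(z)^k vanishes for k > n. *)
Definition fps_comp f g : nat -> K :=
  fun n => \sum_(k < n.+1) f k * fps_exp g k n.

Definition fps_onep M : nat -> K := fun n => fps_one n + M n.

(* z * f(z) *)
Definition fps_mulX f : nat -> K := fun n => if n is m.+1 then f m else 0.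

(* The inverse for fps_mul, when f has constant term 1: see fps_invP. *)
Definition fps_inv f : nat -> K :=
  xget (fun=> 0) (fun g => fps_mul f g = fps_one).

Definition moment_series (m : nat -> K) : nat -> K :=
  fun n => if n == 0%N then 0 else m n.

Definition eta_series M : nat -> K := fps_mul M (fps_inv (fps_onep M)).

(* R(z(1 + M(z))) = M(z); the unique solution exists when M has zero constant
   term, see R_series_unique. *)
Definition is_R_series M r : Prop :=
  r 0%N = 0 /\ fps_comp r (fps_mulX (fps_onep M)) = M.

Definition R_series M : nat -> K := xget (fun=> 0) (is_R_series M).

Lemma fps_inv_ex f : f 0%N = 1 -> exists g, fps_mul f g = fps_one.
Proof.
move=> f0.
pose F g n := fps_one n - \sum_(i < n) f i.+1 * g (n - i.+1)%N.
have [r s n rs|g Fg] := @local_fixpoint K nat id F.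
  congr (_ - _); apply: eq_bigr => i _; congr (_ * _); apply: rs => /=.
  by rewrite ltn_subrL /=; apply: leq_ltn_trans (ltn_ord i).
exists g; apply/funext => n.
by rewrite /fps_mul big_ord_recl /= f0 mul1r subn0 {1}Fg /F subrK.
Qed.

Lemma fps_inv_uniq f g h : f 0%N = 1 ->
  fps_mul f g = fps_one -> fps_mul f h = fps_one -> g = h.
Proof.
move=> f0 fg fh.
pose F g n := fps_one n - \sum_(i < n) f i.+1 * g (n - i.+1)%N.
apply: (@local_fixpoint_uniq K nat id F) => [r s n rs|n|n].
- congr (_ - _); apply: eq_bigr => i _; congr (_ * _); apply: rs => /=.
  by rewrite ltn_subrL /=; apply: leq_ltn_trans (ltn_ord i).
- by rewrite /F -fg /fps_mul big_ord_recl /= f0 mul1r subn0 addrK.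
- by rewrite /F -fh /fps_mul big_ord_recl /= f0 mul1r subn0 addrK.
Qed.

Lemma fps_invP f : f 0%N = 1 -> fps_mul f (fps_inv f) = fps_one.
Proof.
move=> f0; apply: (xgetPex _ (P := fun g => fps_mul f g = fps_one)).
exact: fps_inv_ex.
Qed.

Lemma fps_expX f k n : f 0%N = 1 -> (n <= k)%N ->
  fps_exp (fps_mulX f) k n = (n == k)%:R.
Proof.
move=> f0; elim: k n => [|k IHk] n; first by rewrite leqn0 => /eqP->.
rewrite /fps_exp iterS -/(fps_exp (fps_mulX f) k) /fps_mul big_ord_recl mul0r add0r.
case: n => [|n]; rewrite ?ltnS => nk; first by rewrite big_ord0.
rewrite big_ord_recl /= f0 mul1r subSS subn0 IHk // eqSS big1 ?addr0 // => i _.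
have lt_n : (n - i.+1 < n)%N by rewrite ltn_subrL /= (leq_ltn_trans _ (ltn_ord i)).
rewrite /bump /= !add1n subSS IHk; last exact: leq_trans (ltnW lt_n) nk.
by rewrite ltn_eqF ?mulr0 //; apply: leq_trans lt_n nk.
Qed.

Lemma R_series_fix M r : M 0%N = 0 ->
  let g := fps_mulX (fps_onep M) in
  is_R_series M r <-> forall n, r n =
    (if n == 0%N then 0 else M n - \sum_(k < n) r k * fps_exp g k n).
Proof.
move=> M0 g.
have f0 : fps_onep M 0%N = 1 by rewrite /fps_onep M0 addr0.
have E n : fps_comp r g n = \sum_(k < n) r k * fps_exp g k n + r n.
  by rewrite /fps_comp big_ord_recr /= fps_expX // eqxx mulr1.
split=> [[r0 rM] [|n]//=|rE].
  by have /= := congr1 (@^~ n.+1) rM; rewrite -/g E => <-; rewrite addrAC subrr add0r.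
split; first by rewrite rE.
apply/funext => n; rewrite -/g E rE.
by case: n => [|n] /=; rewrite ?big_ord0 ?M0 ?addr0 // addrC subrK.
Qed.

Lemma R_series_unique M : M 0%N = 0 -> exists! r, is_R_series M r.
Proof.
move=> M0; pose F (r : nat -> K) n : K := if n == 0%N then 0 else
  M n - \sum_(k < n) r k * fps_exp (fps_mulX (fps_onep M)) k n.
have Floc r s n : (forall m, (m < n)%N -> r m = s m) -> F r n = F s n.
  move=> rs; rewrite /F; case: ifP => // _; congr (_ - _).
  by apply: eq_bigr => k _; rewrite rs.
have [r Fr] := @local_fixpoint K nat id F Floc.
exists r; split=> [|s /(R_series_fix _ M0) Fs]; first exact/R_series_fix.
exact: (@local_fixpoint_uniq K nat id F Floc).
Qed.

Lemma R_seriesP M : M 0%N = 0 -> is_R_series M (R_series M).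
Proof.
by move=> /R_series_unique[r [rM _]]; apply: (xgetPex _); exists r.
Qed.

End OneVariable.

Section NonCrossing.
Variable n : nat.

Definition noncrossing (P : {set {set 'I_n}}) : bool :=
  [forall B in P, forall C in P, forall a in B, forall b in C,
   forall c in B, forall d in C,
     [&& (a < b)%N, (b < c)%N & (c < d)%N] ==> (B == C)].

Definition NC : {set {set {set 'I_n}}} :=
  [set P : {set {set 'I_n}} | finset.partition P [set: 'I_n] & noncrossing P].

End NonCrossing.

(* A word over {1, *}: the letter 1 is false and the letter * is true. *)
Definition word := seq bool.

(* enum B lists B in increasing order. *)
Definition subword (w : word) (B : {set 'I_(size w)}) : word :=
  [seq tnth (in_tuple w) i | i <- enum B].

Definition evalw (A : pzSemiRingType) (x xs : A) (w : word) : A :=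
  \prod_(l <- w) (if l then xs else x).

Definition alternating (w : word) : Prop :=
  exists2 m : nat, (0 < m)%N &
    w = flatten (nseq m [:: false; true])
    \/ w = flatten (nseq m [:: true; false]).

(* A formal power series in the non-commuting indeterminates z, z^* is the
   family of its coefficients, indexed by the words. *)
Section TwoVariables.
Variable K : comNzRingType.
Implicit Types f g h M r : word -> K.

Definition ncs_one : word -> K := fun w => (w == [::])%:R.

Definition ncs_mul f g : word -> K :=
  fun w => \sum_(i < (size w).+1) f (take i w) * g (drop i w).

Definition ncs_onep M : word -> K := fun w => ncs_one w + M w.

Definition is_ncs_inv f g : Prop :=
  ncs_mul f g = ncs_one /\ ncs_mul g f = ncs_one.

Definition ncs_inv f : word -> K := xget (fun=> 0) (is_ncs_inv f).

Definition nc_moment_series (m : word -> K) : word -> K :=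
  fun w => if w == [::] then 0 else m w.

Definition nc_eta_series M : word -> K := ncs_mul M (ncs_inv (ncs_onep M)).

(* The moment-cumulant formula; the unique solution exists by
   nc_R_series_unique. *)
Definition is_nc_R_series M r : Prop :=
  r [::] = 0 /\
  forall w, w != [::] ->
    M w = \sum_(P in NC (size w)) \prod_(B in P) r (subword B).

Definition nc_R_series M : word -> K := xget (fun=> 0) (is_nc_R_series M).

Lemma ncs_mul_nil f g : ncs_mul f g [::] = f [::] * g [::].
Proof. by rewrite /ncs_mul big_ord1. Qed.

Lemma ncs_mul_cons f g a w : ncs_mul f g (a :: w) =
  f [::] * g (a :: w) + ncs_mul (fun v => f (a :: v)) g w.
Proof. by rewrite /ncs_mul big_ord_recl. Qed.

Lemma ncs_mulA f g h : ncs_mul f (ncs_mul g h) = ncs_mul (ncs_mul f g) h.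
Proof.
have lin (c : K) (u v k : word -> K) w :
    ncs_mul (fun x => c * u x + v x) k w = c * ncs_mul u k w + ncs_mul v k w.
  rewrite /ncs_mul mulr_sumr -big_split /=; apply: eq_bigr => i _.
  by rewrite mulrDl mulrA.
apply/funext => w; elim: w f g h => [|a w IHw] f g h.
  by rewrite !ncs_mul_nil mulrA.
rewrite !ncs_mul_cons IHw ncs_mul_nil.
under [X in _ = _ + ncs_mul X _ _]eq_fun do rewrite ncs_mul_cons.
by rewrite lin mulrDr !mulrA addrA.
Qed.

Lemma ncs_mul1l f : ncs_mul ncs_one f = f.
Proof.
apply/funext => w; rewrite /ncs_mul big_ord_recl take0 drop0 mul1r big1 ?addr0//.
by move=> i _; case: w i => [|a w] [i ilt] //=; rewrite mul0r.
Qed.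

Lemma ncs_mul1r f : ncs_mul f ncs_one = f.
Proof.
apply/funext => w; rewrite /ncs_mul big_ord_recr /= take_size drop_size mulr1.
rewrite big1 ?add0r// => i _; rewrite /ncs_one -size_eq0 size_drop subn_eq0.
by rewrite leqNgt ltn_ord mulr0.
Qed.

Lemma ncs_inv_unique f : f [::] = 1 -> exists! g, is_ncs_inv f g.
Proof.
move=> f0.
pose F g w := ncs_one w -
  \sum_(i < size w) f (take i.+1 w) * g (drop i.+1 w).
have [r s w rs|g Fg] := @local_fixpoint K word size F.
  congr (_ - _); apply: eq_bigr => i _; congr (_ * _); apply: rs.
  by rewrite size_drop ltn_subrL /=; apply: leq_ltn_trans (ltn_ord i).
pose G g w := ncs_one w - \sum_(i < size w) g (take i w) * f (drop i w).
have [r s w rs|h Gh] := @local_fixpoint K word size G.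
  congr (_ - _); apply: eq_bigr => i _; congr (_ * _); apply: rs.
  by rewrite size_take ltn_ord.
have fg : ncs_mul f g = ncs_one.
  apply/funext => w; rewrite /ncs_mul big_ord_recl take0 drop0 f0 mul1r.
  by rewrite {1}Fg /F subrK.
have hf : ncs_mul h f = ncs_one.
  apply/funext => w; rewrite /ncs_mul big_ord_recr /= take_size drop_size f0.
  by rewrite mulr1 Gh /G addrC subrK.
have hg : h = g by rewrite -[h]ncs_mul1r -fg ncs_mulA hf ncs_mul1l.
exists g; split=> [|k [fk _]]; first by split=> //; rewrite -hg.
by rewrite -hg -[h]ncs_mul1r -fk ncs_mulA hf ncs_mul1l.
Qed.

Lemma ncs_invP f : f [::] = 1 -> is_ncs_inv f (ncs_inv f).
Proof.
by move=> /ncs_inv_unique[g [fg _]]; apply: (xgetPex _); exists g.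
Qed.

Lemma size_subword (w : word) (B : {set 'I_(size w)}) :
  size (subword B) = #|B|.
Proof. by rewrite size_map cardE. Qed.

Lemma subwordT (w : word) : subword [set: 'I_(size w)] = w.
Proof.
rewrite /subword; transitivity (map (tnth (in_tuple w)) (enum 'I_(size w))).
  by congr map; apply: eq_enum => i; rewrite finset.in_setT.
exact: map_tnth_enum.
Qed.

Lemma NC_full n : (0 < n)%N -> [set [set: 'I_n]] \in NC n.
Proof.
move=> n0; rewrite inE; apply/andP; split.
  apply/and3P; split; first by rewrite /finset.cover big_set1.
    by apply/finset.trivIsetP => A B; rewrite !inE => /eqP-> /eqP->; rewrite eqxx.
  rewrite inE; apply/eqP => /setP /(_ (Ordinal n0)).
  by rewrite !inE.
apply/forall_inP => B; rewrite inE => /eqP->.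
apply/forall_inP => C; rewrite inE => /eqP->.
by do 4!apply/forall_inP => ? _; rewrite eqxx implybT.
Qed.

Lemma NC_proper n (P : {set {set 'I_n}}) B :
  P \in NC n -> P != [set [set: 'I_n]] -> B \in P -> (#|B| < n)%N.
Proof.
rewrite inE => /andP[/and3P[/eqP covP trivP P0] _] PT BP.
rewrite -[n in ltnRHS]card_ord -finset.cardsT; apply: proper_card.
rewrite finset.properEneq finset.subsetT andbT; apply: contra PT => /eqP BT.
apply/eqP/setP => C; rewrite inE; apply/idP/eqP => [CP|->]; last by rewrite -BT.
rewrite -BT; apply/eqP; apply/negPn/negP => CB.
have := finset.trivIsetP trivP _ _ CP BP CB.
rewrite BT -finset.setI_eq0 finset.setIT => /eqP C0.
by rewrite -C0 CP in P0.
Qed.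

Lemma nc_R_series_unique M : exists! r, is_nc_R_series M r.
Proof.
pose F (r : word -> K) w : K := if w == [::] then 0 else
  M w - \sum_(P in NC (size w) | P != [set [set: 'I_(size w)]]) \prod_(B in P) r (subword B).
have Floc r s w : (forall v, (size v < size w)%N -> r v = s v) -> F r w = F s w.
  move=> rs; rewrite /F; case: ifP => // _; congr (_ - _).
  apply: eq_bigr => P /andP[PNC PT]; apply: eq_bigr => B BP; apply: rs.
  by rewrite size_subword; apply: NC_proper BP.
have RF r : is_nc_R_series M r <-> forall w, r w = F r w.
  have E w : w != [::] ->
      \sum_(P in NC (size w)) \prod_(B in P) r (subword B) = r w +
      \sum_(P in NC (size w) | P != [set [set: 'I_(size w)]]) \prod_(B in P) r (subword B).
    move=> w0; rewrite (bigD1 [set [set: 'I_(size w)]]) /=; last first.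
      by apply: NC_full; rewrite lt0n size_eq0.
    by rewrite big_set1 subwordT.
  split=> [[r0 rM] w|rF].
    rewrite /F; case: eqVneq => [->//|w0].
    by rewrite rM // E // addrK.
  split; first by rewrite rF /F eqxx.
  by move=> w w0; rewrite E // rF /F (negPf w0) subrK.
have [r Fr] := @local_fixpoint K word size F Floc.
exists r; split=> [|s /RF Fs]; first exact/RF.
exact: (@local_fixpoint_uniq K word size F Floc).
Qed.

Lemma nc_R_seriesP M : is_nc_R_series M (nc_R_series M).
Proof.
by have [r [rM _]] := nc_R_series_unique M; apply: (xgetPex _); exists r.
Qed.

End TwoVariables.

(* The norm is a field of the mixin because the hierarchy has no structure that
   extends both algType and completeNormedModType. *)
HB.mixin Record isCstarAlgebra (R : realType) A of GRing.Algebra R[i] A := {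
  star : A -> A;
  starK : involutive star;
  starD : {morph star : x y / x + y};
  starZ : forall (c : R[i]) x, star (c *: x) = c^* *: star x;
  starM : forall x y, star (x * y) = star y * star x;
  cnorm : A -> R;
  cnorm_ge0 : forall x, 0 <= cnorm x;
  cnorm0_eq0 : forall x, cnorm x = 0 -> x = 0;
  cnormD_le : forall x y, cnorm (x + y) <= cnorm x + cnorm y;
  cnormZ : forall (c : R[i]) x, ((cnorm (c *: x))%:C)%C = `|c| * ((cnorm x)%:C)%C;
  cnormM_le : forall x y, cnorm (x * y) <= cnorm x * cnorm y;
  cnorm_complete : forall u : nat -> A,
    (forall e : R, 0 < e -> exists N, forall m n, (N <= m)%N -> (N <= n)%N ->
       cnorm (u m - u n) < e) ->
    exists l : A, forall e : R, 0 < e -> exists N, forall n, (N <= n)%N ->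
      cnorm (u n - l) < e;
  cnorm_starM : forall x, cnorm (star x * x) = cnorm x ^+ 2
}.

#[short(type="cstarAlgType")]
HB.structure Definition CstarAlgebra (R : realType) :=
  {A of GRing.Algebra R[i] A & isCstarAlgebra R A}.

Section FreeAlgebra.
Variable K : comNzRingType.

Definition ncpoly : Type := {malg K[{fmonom bool}]}.
HB.instance Definition _ := GRing.Lalgebra.on ncpoly.

Lemma ncpoly_scaleAr (c : K) (p q : ncpoly) : c *: (p * q) = p * (c *: q).
Proof.
apply/malgP => k; rewrite mcoeffZ.
rewrite (mcoeffMlw k (finmap.fsubset_refl _) (finmap.fsubset_refl _)).
rewrite (mcoeffMlw k (finmap.fsubset_refl _) (msuppZ_le _ _)).
rewrite mulr_sumr; apply: eq_bigr => i _; rewrite mulr_sumr; apply: eq_bigr => j _.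
by rewrite mcoeffZ mulrnAr mulrCA.
Qed.
HB.instance Definition _ :=
  GRing.Lalgebra_isAlgebra.Build K ncpoly ncpoly_scaleAr.

(* The free algebra K<Z, Z^*>, with Z and Z^* the generators indexed by the
   letters false and true. *)
Definition Zvar : ncpoly := mkmalgU (fmu false) 1.
Definition Zstar : ncpoly := mkmalgU (fmu true) 1.

End FreeAlgebra.

Arguments Zvar {K}.
Arguments Zstar {K}.

Definition elt_moment_series (K : comNzRingType) (A : algType K) (phi : A -> K)
  (a : A) : nat -> K := moment_series (fun n => phi (a ^+ n)).

Definition elt_R_series (K : comNzRingType) (A : algType K) (phi : A -> K)
  (a : A) : nat -> K := R_series (elt_moment_series phi a).

Section Distributions.
Variable R : realType.
Local Notation C := R[i].
Local Notation probR := (probability (measurableTypeR R) R).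
Implicit Types (sigma tau : probR) (mu nu : {scalar ncpoly C}).

Definition Pc sigma : Prop := exists2 S : set R, compact S & sigma S = 1%E.

Definition Pc_plus sigma : Prop :=
  exists2 S : set R, compact S /\ (S `<=` `[0, +oo[)%classic & sigma S = 1%E.

Definition moment sigma (n : nat) : R := \int[sigma]_t ((t : R) ^+ n).

Definition M_meas sigma : nat -> C :=
  moment_series (fun n => (moment sigma n)%:C%C).
Definition eta_meas sigma : nat -> C := eta_series (M_meas sigma).
Definition R_meas sigma : nat -> C := R_series (M_meas sigma).

(* The maps B, Phi and Psi are given by their graphs, since the existence of
   their values is a theorem that is not proved here: tau = B(sigma). *)
Definition is_B sigma tau : Prop := Pc tau /\ R_meas tau = eta_meas sigma.

Definition is_state (A : cstarAlgType R) (phi : {scalar A}) : Prop :=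
  phi 1 = 1 /\ forall x : A, 0 <= phi (star x * x).

Definition Dc mu : Prop :=
  mu 1 = 1 /\
  exists (A : cstarAlgType R) (phi : {scalar A}) (a : A), is_state phi /\
    forall w : word, w != [::] ->
      mu (evalw Zvar Zstar w) = phi (evalw a (star a) w).

Definition nc_M mu : word -> C :=
  nc_moment_series (fun w => mu (evalw Zvar Zstar w)).
Definition nc_eta mu : word -> C := nc_eta_series (nc_M mu).
Definition nc_R mu : word -> C := nc_R_series (nc_M mu).

Definition eta_diagonal mu : Prop :=
  forall w : word, w != [::] -> ~ alternating w -> nc_eta mu w = 0.

(* mu = Phi(sigma1, sigma2) *)
Definition is_Phi sigma1 sigma2 mu : Prop :=
  [/\ Dc mu, eta_diagonal mu,
      forall n, mu ((Zvar * Zstar) ^+ n) = (moment sigma1 n)%:C%C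
    & forall n, mu ((Zstar * Zvar) ^+ n) = (moment sigma2 n)%:C%C].

(* nu = Psi(sigma1, sigma2) *)
Definition is_Psi sigma1 sigma2 nu : Prop :=
  exists2 mu, is_Phi sigma1 sigma2 mu & Dc nu /\ nc_R nu = nc_eta mu.

End Distributions.

(* Main.v *)
(* By the first-block form of the moment-cumulant formula, write N, B for the
   moment series of ZZ^* and Z^*Z under nu, and f, g for the coefficients of
   R_nu along (ZZ^* )^m and (Z^*Z)^m.  The block of the first letter alternates,
   so the words skipped between its letters are powers of Z^*Z and of ZZ^* in
   turn; hence N = f(z(1+N)(1+B)) and B = g(z(1+N)(1+B)).  Since mu is
   eta-diagonal, f = eta_sigma1 = R_tau1 and g = eta_sigma2 = R_tau2.  With
   T = M_tau2 the relation g(z(1+T)) = T makes T(z(1+N)) and B solutions of the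
   same fixed point equation h = g(z(1+N)(1+h)), so they agree, and
   f(z(1+T)) at z(1+N) is f(z(1+N)(1+B)) = N. *)
Require Import Defs.
From mathcomp Require Import all_boot all_order all_algebra.
From mathcomp Require Import complex monalg.
From mathcomp Require Import zify.
From mathcomp Require Import all_classical all_reals all_analysis.
Import GRing.Theory.
Local Open Scope ring_scope.

(** * Formal power series in one variable: products, composition, R-series *)

Section OneVariableSeries.
Context {K : comNzRingType}.
Implicit Types f g h y M : nat -> K.

Lemma fps_mulA f g h : fps_mul f (fps_mul g h) = fps_mul (fps_mul f g) h.
Proof.
(* A one-variable series is a series on words that depends on the length only. *)
have E u v (w : word) :
    ncs_mul (u \o size) (v \o size) w = fps_mul u v (size w) :> K.
  apply: eq_bigr => i _; have le_i : (i <= size w)%N by rewrite -ltnS.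
  by rewrite /= size_drop size_takel.
apply/funext => n.
have := congr1 (@^~ (nseq n true)) (ncs_mulA (f \o size) (g \o size) (h \o size)).
have -> : ncs_mul (g \o size) (h \o size) = fps_mul g h \o size.
  by apply/funext => w; rewrite E.
have -> : ncs_mul (f \o size) (g \o size) = fps_mul f g \o size.
  by apply/funext => w; rewrite E.
by rewrite /= !E size_nseq.
Qed.

Lemma fps_mulC f g : fps_mul f g = fps_mul g f.
Proof.
apply/funext => n; rewrite /fps_mul (reindex_inj rev_ord_inj) /=.
by apply: eq_bigr => i _; rewrite mulrC subSS subKn // -ltnS.
Qed.

Lemma fps_mul1l f : fps_mul (fps_one K) f = f.
Proof.
apply/funext => n; rewrite /fps_mul big_ord_recl subn0 mul1r big1 ?addr0 //.
by move=> i _; rewrite mul0r.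
Qed.

Lemma fps_mulXl f g : fps_mul (fps_mulX f) g = fps_mulX (fps_mul f g).
Proof.
apply/funext => -[|n]; first by rewrite /fps_mul big_ord1 mul0r.
by rewrite {1}/fps_mul big_ord_recl mul0r add0r.
Qed.

Lemma eq_fps_mul n f f' g g' :
  (forall i, (i <= n)%N -> f i = f' i) -> (forall i, (i <= n)%N -> g i = g' i) ->
  fps_mul f g n = fps_mul f' g' n.
Proof.
move=> ff' gg'; apply: eq_bigr => i _.
by rewrite ff' ?gg' ?leq_subr // -ltnS.
Qed.

Lemma eq_fps_exp n k f f' :
  (forall i, (i <= n)%N -> f i = f' i) -> fps_exp f k n = fps_exp f' k n.
Proof.
elim: k n => // k IHk n ff'; apply: eq_fps_mul => // i ilen.
by apply: IHk => j jlei; apply: ff'; apply: leq_trans ilen.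
Qed.

Lemma eq_fps_comp n g f f' :
  (forall i, (i <= n)%N -> f i = f' i) -> fps_comp g f n = fps_comp g f' n.
Proof.
by move=> ff'; apply: eq_bigr => k _; congr (_ * _); apply: eq_fps_exp.
Qed.

(** The zero constant term of [f] kills the only product that involves [g n]. This gain of one
    degree drives the inductions on coefficients below. *)
Lemma eq_fps_mul0 n f g g' : f 0%N = 0 ->
  (forall i, (i < n)%N -> g i = g' i) -> fps_mul f g n = fps_mul f g' n.
Proof.
move=> f0 gg'; rewrite /fps_mul !big_ord_recl f0 !mul0r; congr (_ + _).
apply: eq_bigr => i _; rewrite gg' //= ltn_subrL /=.
exact: leq_ltn_trans (ltn_ord i).
Qed.

Lemma fps_expS f k : fps_exp f k.+1 = fps_mul f (fps_exp f k).
Proof. by []. Qed.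

Lemma fps_exp_small f k n : f 0%N = 0 -> (n < k)%N -> fps_exp f k n = 0.
Proof.
move=> f0; elim: k n => // k IHk n nk.
rewrite fps_expS (@eq_fps_mul0 _ _ _ (fun=> 0) f0).
  by rewrite /fps_mul big1 // => i _; rewrite mulr0.
by move=> i lt_in; apply: IHk; apply: leq_trans lt_in _.
Qed.

(** Horner's rule: [f] is its constant term plus z times the shifted series. The truncated sums
    agree because y^k has no coefficient in degrees below k. *)
Lemma fps_comp_recl f y n : y 0%N = 0 ->
  fps_comp f y n =
    f 0%N * (n == 0%N)%:R + fps_mul y (fps_comp (fun k => f k.+1) y) n.
Proof.
move=> y0; rewrite /fps_comp big_ord_recl; congr (_ + _).
transitivity (\sum_(k < n.+1) f k.+1 * fps_exp y k.+1 n).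
  by rewrite [RHS]big_ord_recr (fps_exp_small _ _ _ y0 (ltnSn n)) mulr0 /= addr0.
under eq_bigr do rewrite fps_expS /fps_mul mulr_sumr.
rewrite exchange_big; apply: eq_bigr => i _ /=; rewrite mulr_sumr.
rewrite (big_ord_widen n.+1
  (fun k => y i * (f k.+1 * fps_exp y k (n - i)))); last by rewrite ltnS leq_subr.
rewrite [RHS]big_mkcond; apply: eq_bigr => k _ /=; rewrite mulrCA.
by case: ltnP => // le_nk; rewrite (fps_exp_small _ _ _ y0 le_nk) !mulr0.
Qed.

Lemma fps_comp0 f y : fps_comp f y 0%N = f 0%N.
Proof. by rewrite /fps_comp big_ord1 mulr1. Qed.

Lemma fps_comp_mulX f y : y 0%N = 0 ->
  fps_comp (fps_mulX f) y = fps_mul y (fps_comp f y).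
Proof. by move=> y0; apply/funext => n; rewrite fps_comp_recl // mul0r add0r. Qed.

Lemma fps_comp_onep f y : y 0%N = 0 ->
  fps_comp (fps_onep f) y = fps_onep (fps_comp f y).
Proof.
move=> y0; apply/funext => n; rewrite /fps_onep /fps_comp.
under eq_bigr do rewrite mulrDl.
rewrite big_split; congr (_ + _) => /=.
by rewrite big_ord_recl mul1r big1 ?addr0 // => i _; rewrite mul0r.
Qed.

(** Induction on the degree, for all [f] at once: Horner's rule on [f] leaves a factor [y], so the
    shifted series is needed in lower degrees only. *)
Lemma fps_comp_mul f g y : y 0%N = 0 ->
  fps_comp (fps_mul f g) y = fps_mul (fps_comp f y) (fps_comp g y).
Proof.
move=> y0; apply/funext => n.
elim/ltn_ind: n f => n IHn f.
have recl h i : fps_comp h y i =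
    (fun j => h 0%N * (j == 0%N)%:R + fps_mul y (fps_comp (fun k => h k.+1) y) j) i.
  exact: fps_comp_recl.
rewrite (@eq_fps_mul n _ _ _ _ (fun i _ => recl f i) (fun _ _ => erefl)).
have -> : fps_comp (fps_mul f g) y n = f 0%N * fps_comp g y n +
    fps_mul y (fps_comp (fps_mul (fun k => f k.+1) g) y) n.
  rewrite !(fps_comp_recl _ _ _ y0) mulrDr mulrA.
  rewrite {1}/fps_mul big_ord1 -addrA; congr (_ + _).
  have -> : fps_comp (fun k => fps_mul f g k.+1) y =
    fun i => f 0%N * fps_comp (fun k => g k.+1) y i +
       fps_comp (fps_mul (fun k => f k.+1) g) y i.
    apply/funext => i; rewrite /fps_comp mulr_sumr -big_split /=.
    apply: eq_bigr => k _.
    by rewrite {1}/fps_mul big_ord_recl mulrDl -mulrA subn0.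
  rewrite /fps_mul mulr_sumr -big_split; apply: eq_bigr => i _ /=.
  by rewrite mulrDr mulrCA.
rewrite (@eq_fps_mul0 n y _ _ y0 (fun i lt_in => IHn i lt_in _)).
rewrite fps_mulA; set z := fps_mul y _.
rewrite /fps_mul; under [RHS]eq_bigr do rewrite mulrDl.
rewrite big_split /=; congr (_ + _).
rewrite big_ord_recl mulr1 subn0 big1 ?addr0 // => i _.
by rewrite mulr0 mul0r.
Qed.

Lemma fps_comp_exp f y k : y 0%N = 0 ->
  fps_comp (fps_exp f k) y = fps_exp (fps_comp f y) k.
Proof.
move=> y0; elim: k => [|k IHk].
  apply/funext => n; rewrite /fps_comp big_ord_recl mul1r big1 ?addr0 //.
  by move=> i _; rewrite mul0r.
by rewrite !fps_expS fps_comp_mul // IHk.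
Qed.

(** Both sides are the double sum of f_j [z^k]g^j [z^n]y^k; the vanishing of [z^k]g^j for j > k
    makes the ranges agree. *)
Lemma fps_compA f g y : g 0%N = 0 -> y 0%N = 0 ->
  fps_comp (fps_comp f g) y = fps_comp f (fps_comp g y).
Proof.
move=> g0 y0; apply/funext => n; rewrite {1}/fps_comp.
transitivity (\sum_(j < n.+1) \sum_(k < n.+1)
                f j * (fps_exp g j k * fps_exp y k n)).
  rewrite exchange_big; apply: eq_bigr => k _ /=.
  rewrite /fps_comp (big_ord_widen n.+1 (fun j => f j * fps_exp g j k)) //.
  rewrite big_mkcond mulr_suml; apply: eq_bigr => j _ /=.
  rewrite mulrA; case: ltnP => // le_kj.
  by rewrite (fps_exp_small _ _ _ g0 le_kj) mulr0.
by apply: eq_bigr => j _; rewrite -mulr_sumr -fps_comp_exp.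
Qed.

(** Since [y] has no constant term, the right-hand side in degree n depends on [h] in degrees below
    n only. *)
Lemma fps_comp_fix_uniq g y h h' : y 0%N = 0 ->
  h = fps_comp g (fps_mul y (fps_onep h)) ->
  h' = fps_comp g (fps_mul y (fps_onep h')) -> h = h'.
Proof.
move=> y0 hE h'E; apply/funext => n; elim/ltn_ind: n => n IHn.
rewrite hE h'E; apply: eq_fps_comp => i le_in; apply: eq_fps_mul0 => // j lt_ji.
by rewrite /fps_onep IHn //; apply: leq_trans lt_ji le_in.
Qed.

Lemma R_series_uniq M r : M 0%N = 0 -> is_R_series M r -> R_series M = r.
Proof.
move=> M0 rM; have [s [_ uniq_s]] := R_series_unique M0.
by rewrite -(uniq_s _ (R_seriesP M0)) (uniq_s _ rM).
Qed.

Lemma eta_series_uniq M f : M 0%N = 0 -> M = fps_mul f (fps_onep M) ->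
  eta_series M = f.
Proof.
move=> M0 Mf; rewrite /eta_series {1}Mf -fps_mulA fps_invP; last first.
  by rewrite /fps_onep M0 addr0.
by rewrite fps_mulC fps_mul1l.
Qed.

(* T solves h = g(y(1 + h)) at y = z, hence T(y) solves it at y = z(1 + N). *)
Lemma R_series_two f g N B T : f 0%N = 0 -> g 0%N = 0 ->
  N = fps_comp f (fps_mulX (fps_mul (fps_onep N) (fps_onep B))) ->
  B = fps_comp g (fps_mulX (fps_mul (fps_onep N) (fps_onep B))) ->
  T = fps_comp g (fps_mulX (fps_onep T)) ->
  R_series N = fps_comp f (fps_mulX (fps_onep T)).
Proof.
move=> f0 g0 NE BE TE; set y := fps_mulX (fps_onep N).
have N0 : N 0%N = 0 by rewrite NE fps_comp0.
have y0 : y 0%N = 0 by [].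
have comp_y h : fps_comp (fps_comp h (fps_mulX (fps_onep T))) y =
    fps_comp h (fps_mul y (fps_onep (fps_comp T y))).
  by rewrite fps_compA // fps_comp_mulX // fps_comp_onep.
have TB : fps_comp T y = B.
  apply: (@fps_comp_fix_uniq g y) => //; last by rewrite fps_mulXl.
  by rewrite {1}TE comp_y.
apply: R_series_uniq => //; split; first by rewrite fps_comp0.
by rewrite -/y comp_y TB fps_mulXl.
Qed.

End OneVariableSeries.

(** * Non-crossing partitions of subsets of ['I_n] and their restrictions *)

Section Noncrossing.
Context {n : nat}.
Implicit Types (P Q : {set {set 'I_n}}) (B C D S T : {set 'I_n}).
Implicit Types (a x y z t : 'I_n) (b d : nat).

(** Blocks stay in the ambient ['I_n] whatever [S] is, so that cutting and gluing intervals requires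
    no renumbering. *)
Definition ncpart S P : bool := finset.partition P S && noncrossing P.

Definition same_block P x y : bool := [exists C in P, (x \in C) && (y \in C)].

Lemma same_blockP P x y :
  reflect (exists C, [/\ C \in P, x \in C & y \in C]) (same_block P x y).
Proof.
apply: (iffP exists_inP) => [[C CP /andP[xC yC]]|[C [CP xC yC]]]; exists C => //.
by rewrite xC.
Qed.

(** Non-crossing can be read on the relation alone: once [x] and [y] share a block, disjointness
    identifies the block of [x], [z] with that of [y], [t]. *)
Lemma ncpartP S P : reflect
  [/\ forall C, C \in P -> C != finset.set0,
      forall x, (x \in S) = same_block P x x,
      forall C D x, C \in P -> D \in P -> x \in C -> x \in D -> C = D
    & forall x y z t, (x < y)%N -> (y < z)%N -> (z < t)%N ->
        same_block P x z -> same_block P y t -> same_block P x y]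
  (ncpart S P).
Proof.
apply: (iffP andP) =>
  [[/and3P[/eqP covP /finset.trivIsetP trivP P0] ncP]|[P0 PS trivP ncP]].
  have disj C D x : C \in P -> D \in P -> x \in C -> x \in D -> C = D.
    move=> CP DP xC xD; apply/eqP/negPn/negP => /(trivP _ _ CP DP).
    by move=> /disjointFr /(_ xC); rewrite xD.
  split=> // [C CP|x|x y z t xy yz zt].
  - by apply: contraNneq P0 => <-.
  - rewrite -covP; apply/finset.bigcupP/same_blockP => [[C CP xC]|[C [CP xC _]]];
      by exists C.
  - move=> /same_blockP[C [CP xC zC]] /same_blockP[D [DP yD tD]].
    apply/same_blockP; exists C; split=> //.
    move: ncP => /forall_inP/(_ C CP)/forall_inP/(_ D DP)/forall_inP/(_ x xC).
    move=> /forall_inP/(_ y yD)/forall_inP/(_ z zC)/forall_inP/(_ t tD).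
    by rewrite xy yz zt /= => /eqP->.
split.
  apply/and3P; split.
  - apply/eqP/setP => x; rewrite PS.
    apply/finset.bigcupP/same_blockP => [[C CP xC]|[C [CP xC _]]]; by exists C.
  - apply/finset.trivIsetP => C D CP DP; apply: contraNT => /pred0Pn[x /andP[xC xD]].
    by apply/eqP; apply: trivP xC xD.
  - by apply/negP => /P0; rewrite eqxx.
apply/forall_inP => C CP; apply/forall_inP => D DP.
apply/forall_inP => x xC; apply/forall_inP => y yD.
apply/forall_inP => z zC; apply/forall_inP => t tD; apply/implyP => /and3P[xy yz zt].
have /same_blockP[E [EP xE yE]] : same_block P x y.
  by apply: ncP xy yz zt _ _; apply/same_blockP; [exists C|exists D].
by rewrite (trivP _ _ _ CP EP xC xE) (trivP _ _ _ DP EP yD yE).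
Qed.

Lemma same_block_sym P x y : same_block P x y = same_block P y x.
Proof. by apply: eq_existsb => C; rewrite [_ && (y \in C)]andbC. Qed.

Lemma same_block_trans S P x y z : ncpart S P ->
  same_block P x y -> same_block P y z -> same_block P x z.
Proof.
move=> /ncpartP[_ _ trivP _] /same_blockP[C [CP xC yC]] /same_blockP[D [DP yD zD]].
by apply/same_blockP; exists C; split=> //; rewrite (trivP C D y).
Qed.

Lemma same_block_dom S P x y : ncpart S P -> same_block P x y ->
  (x \in S) && (y \in S).
Proof.
move=> /ncpartP[_ PS _ _] /same_blockP[C [CP xC yC]]; rewrite !PS.
by apply/andP; split; apply/same_blockP; exists C.
Qed.

Lemma same_block_class S P C x : ncpart S P -> C \in P -> x \in C ->
  C = [set y | same_block P x y].
Proof.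
move=> /ncpartP[_ _ trivP _] CP xC; apply/setP => y; rewrite inE.
apply/idP/same_blockP => [yC|[D [DP xD yD]]]; first by exists C.
by rewrite (trivP C D x).
Qed.

(** Blocks are nonempty and each is the class of any of its elements, so the relation recovers the
    partition. *)
Lemma ncpart_eq S P Q : ncpart S P -> ncpart S Q ->
  same_block P =2 same_block Q -> P = Q.
Proof.
suff sub P' Q' : ncpart S P' -> ncpart S Q' ->
    same_block P' =2 same_block Q' -> {subset P' <= Q'}.
  move=> ncP ncQ PQ; apply/setP => C; apply/idP/idP.
    exact: sub PQ C.
  by apply: (sub Q P) => // x y; rewrite PQ.
move=> ncP ncQ PQ C CP.
have [/(_ C CP)/finset.set0Pn[x xC] _ _ _] := ncpartP _ _ ncP.
have : same_block Q' x x by rewrite -PQ; apply/same_blockP; exists C.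
move=> /same_blockP[D [DQ xD _]].
suff -> : C = D by [].
rewrite (same_block_class _ _ _ _ ncP CP xC) (same_block_class _ _ _ _ ncQ DQ xD).
by apply/setP => y; rewrite !inE PQ.
Qed.

Lemma ncpart_set0 P : ncpart finset.set0 P = (P == finset.set0).
Proof.
apply/idP/eqP => [/ncpartP[P0 PS _ _]|->].
  apply/setP => C; rewrite inE; apply/negP => CP.
  have /finset.set0Pn[x xC] := P0 C CP.
  have : x \in finset.set0 by rewrite PS; apply/same_blockP; exists C.
  by rewrite inE.
apply/ncpartP; have no x y : same_block finset.set0 x y = false.
  by apply/same_blockP => -[C []]; rewrite inE.
by split=> [C|x|C D x|x y z t _ _ _]; rewrite ?no ?inE.
Qed.

Definition restr P T : {set {set 'I_n}} := [set C :&: T | C in P] :\ finset.set0.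

Lemma same_block_restr P T x y :
  same_block (restr P T) x y = [&& same_block P x y, x \in T & y \in T].
Proof.
apply/same_blockP/and3P => [[C []]|[/same_blockP[C [CP xC yC]] xT yT]].
  rewrite in_setD1 => /andP[_ /imsetP[D DP ->]]; rewrite !inE.
  by move=> /andP[xD ->] /andP[yD ->]; split=> //; apply/same_blockP; exists D.
exists (C :&: T); rewrite in_setD1 !inE xC xT yC yT; split=> //; apply/andP; split.
  by apply/finset.set0Pn; exists x; rewrite inE xC.
by apply/imsetP; exists C.
Qed.

Lemma ncpart_restr S T P : T \subset S -> ncpart S P -> ncpart T (restr P T).
Proof.
move=> /fintype.subsetP TS /ncpartP[P0 PS trivP ncP]; apply/ncpartP; split.
- by move=> C; rewrite in_setD1 => /andP[].
- move=> x; rewrite same_block_restr andbb -PS.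
  by case: (boolP (x \in T)) => [/TS->|]; rewrite ?andbF.
- move=> C D x; rewrite !in_setD1.
  move=> /andP[_ /imsetP[C' CP ->]] /andP[_ /imsetP[D' DP ->]].
  by rewrite !inE => /andP[xC _] /andP[xD _]; rewrite (trivP C' D' x).
- move=> x y z t xy yz zt; rewrite !same_block_restr.
  by move=> /and3P[xz -> _] /and3P[yt -> _]; rewrite !andbT; apply: ncP yz zt xz yt.
Qed.

(** The endpoints are numbers rather than ordinals, so that [j] may be [n]. *)
Definition itv (i j : nat) : {set 'I_n} := [set x : 'I_n | (i <= x < j)%N].

(* Empty when d is not covered by P; d may be n. *)
Definition block_of P (d : nat) : {set 'I_n} :=
  [set y | [exists x : 'I_n, (x == d :> nat) && same_block P x y]].

Lemma block_ofP P d y :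
  reflect (exists2 x : 'I_n, x = d :> nat & same_block P x y) (y \in block_of P d).
Proof.
rewrite inE; apply: (iffP existsP) => [[x /andP[/eqP xd xy]]|[x xd xy]]; exists x => //.
by rewrite xd eqxx.
Qed.

Lemma block_of_ord P a y : (y \in block_of P a) = same_block P a y.
Proof. by apply/block_ofP/idP => [[x /val_inj->]|ay] //; exists a. Qed.

Lemma block_of_same S P d x y : ncpart S P -> x \in block_of P d ->
  (y \in block_of P d) = same_block P x y.
Proof.
move=> ncP /block_ofP[z zd zx]; apply/block_ofP/idP => [[z' z'd z'y]|xy].
  have zz : z' = z by apply: val_inj; rewrite /= zd.
  by apply: (same_block_trans _ _ _ _ _ ncP) z'y; rewrite zz same_block_sym.
by exists z => //; exact: same_block_trans ncP zx xy.
Qed.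

Lemma block_of_mem S P a : ncpart S P -> a \in S -> block_of P a \in P.
Proof.
move=> ncP; have [_ -> _ _] := ncpartP _ _ ncP => /same_blockP[C [CP aC _]].
suff -> : block_of P a = C by [].
rewrite (same_block_class _ _ _ _ ncP CP aC).
by apply/setP => y; rewrite block_of_ord inE.
Qed.

(* a becomes a singleton block when d is not covered by Q2. *)
Definition prepend a (d : nat) Q1 Q2 : {set {set 'I_n}} :=
  (a |: block_of Q2 d) |: (Q1 :|: Q2 :\ block_of Q2 d).

Lemma same_block_prepend a d Q1 Q2 x y : same_block (prepend a d Q1 Q2) x y =
  [|| same_block Q1 x y, same_block Q2 x y |
      (x \in a |: block_of Q2 d) && (y \in a |: block_of Q2 d)].
Proof.
apply/same_blockP/or3P => [[C []]|].
  rewrite in_setU1 finset.in_setU in_setD1.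
  case/or3P=> [/eqP-> -> ->|CQ xC yC|/andP[_ CQ] xC yC].
  - exact: Or33.
  - by apply: Or31; apply/same_blockP; exists C.
  - by apply: Or32; apply/same_blockP; exists C.
case=> [/same_blockP[C [CQ xC yC]]|/same_blockP[C [CQ xC yC]]|/andP[xC yC]].
- by exists C; rewrite in_setU1 finset.in_setU CQ orbT.
- have [CE|CE] := eqVneq C (block_of Q2 d).
    by exists (a |: block_of Q2 d); rewrite !in_setU1 -CE xC yC eqxx !orbT.
  by exists C; rewrite in_setU1 finset.in_setU in_setD1 CE CQ !orbT.
- by exists (a |: block_of Q2 d); rewrite in_setU1 eqxx.
Qed.

(** * Gluing a first element to two partitions, and the inverse cut *)

Section Prepend.
Variables (a : 'I_n) (b : nat).

(* d is the successor of a in its block, or b when a is the last element. *)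
Definition is_next P d : Prop :=
  (forall x, same_block P a x -> x != a -> (d <= x)%N) /\
  ((d < b)%N -> exists2 x : 'I_n, x = d :> nat & same_block P a x).

(** If [d < d'], then [d < b], so [d] lies in the block of [a] and differs from [a]; the minimality
    of [d'] contradicts this. *)
Lemma is_next_uniq P d d' : (a < d <= b)%N -> (a < d' <= b)%N ->
  is_next P d -> is_next P d' -> d = d'.
Proof.
wlog le_dd' : d d' / (d <= d')%N.
  by move=> wl ad ad' nd nd'; case/orP: (leq_total d d') => le;
    [exact: wl|symmetry; exact: wl].
move=> ad ad' [_ dP] [d'P _]; apply/eqP; rewrite eqn_leq le_dd' leqNgt.
apply/negP => lt.
have [|x xd ax] := dP; first lia.
have : (d' <= x)%N by apply: d'P => //; apply/eqP => xa; move: ad; rewrite -xd xa; lia.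
lia.
Qed.

Section PrependLemmas.
Variables (d : nat) (Q1 Q2 : {set {set 'I_n}}).
Hypotheses (ad : (a < d)%N) (db : (d <= b)%N).
Hypotheses (ncQ1 : ncpart (itv a.+1 d) Q1) (ncQ2 : ncpart (itv d b) Q2).

Let dom1 x y : same_block Q1 x y -> (a < x < d)%N && (a < y < d)%N.
Proof. by move=> /(same_block_dom _ _ _ _ ncQ1); rewrite !inE. Qed.

Let dom2 x y : same_block Q2 x y -> (d <= x < b)%N && (d <= y < b)%N.
Proof. by move=> /(same_block_dom _ _ _ _ ncQ2); rewrite !inE. Qed.

Let domB x : x \in block_of Q2 d -> (d <= x < b)%N.
Proof. by move=> /block_ofP[y _ /dom2/andP[]]. Qed.

Lemma block_of_prepend : block_of (prepend a d Q1 Q2) a = a |: block_of Q2 d.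
Proof.
apply/setP => y; rewrite block_of_ord same_block_prepend in_setU1 eqxx /=.
case: (boolP (same_block Q1 a y)) => [/dom1|_]; first lia.
by case: (boolP (same_block Q2 a y)) => [/dom2|_] //; lia.
Qed.

(** [Q1] sits strictly between [a] and [d], and [Q2] from [d] on, so only the block enlarged by [a]
    could cross another one. In a crossing with a block of [Q2], the point [a] can be replaced by
    [d], the least point of that side. *)
Lemma ncpart_prepend : ncpart (itv a b) (prepend a d Q1 Q2).
Proof.
have [Q10 Q1S triv1 nc1] := ncpartP _ _ ncQ1.
have [Q20 Q2S triv2 nc2] := ncpartP _ _ ncQ2.
have in1 C x : C \in Q1 -> x \in C -> (a < x < d)%N.
  move=> CQ xC; suff /dom1/andP[] : same_block Q1 x x by [].
  by apply/same_blockP; exists C.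
have in2 C x : C \in Q2 -> x \in C -> (d <= x < b)%N.
  move=> CQ xC; suff /dom2/andP[] : same_block Q2 x x by [].
  by apply/same_blockP; exists C.
have inB C x : C \in Q2 -> x \in C -> x \in block_of Q2 d -> C = block_of Q2 d.
  move=> CQ xC xB; rewrite (same_block_class _ _ _ _ ncQ2 CQ xC).
  by apply/setP => y; rewrite inE (block_of_same _ _ _ _ _ ncQ2 xB).
have sameB x y : x \in block_of Q2 d -> y \in block_of Q2 d -> same_block Q2 x y.
  by move=> xB; rewrite (block_of_same _ _ _ _ _ ncQ2 xB).
apply/ncpartP; split.
- move=> C; rewrite in_setU1 finset.in_setU in_setD1.
  case/or3P=> [/eqP->|/Q10//|/andP[_ /Q20//]].
  by apply/finset.set0Pn; exists a; rewrite in_setU1 eqxx.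
- move=> x; rewrite same_block_prepend -Q1S -Q2S andbb in_setU1 !inE.
  rewrite -(inj_eq val_inj) /=.
  have := domB x; rewrite inE; case: [exists _, _] => [/(_ isT)|_]; lia.
- move=> C D x; rewrite !in_setU1 !finset.in_setU !in_setD1.
  case/or3P=> [/eqP->|CQ|/andP[CB CQ]]; case/or3P=> [/eqP->|DQ|/andP[DB DQ]] //.
  + move=> /[swap] /(in1 _ _ DQ) xd; rewrite in_setU1 -(inj_eq val_inj).
    by move=> /orP[/eqP /= xa|/domB]; lia.
  + move=> /[swap] xD; rewrite in_setU1 -(inj_eq val_inj).
    move=> /orP[/eqP /= xa|xB]; first by have := in2 _ _ DQ xD; lia.
    by move: DB; rewrite (inB _ _ DQ xD xB) eqxx.
  + move=> /(in1 _ _ CQ) xd; rewrite in_setU1 -(inj_eq val_inj).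
    by move=> /orP[/eqP /= xa|/domB]; lia.
  + exact: triv1.
  + by move=> /(in1 _ _ CQ) ? /(in2 _ _ DQ); lia.
  + move=> xC; rewrite in_setU1 -(inj_eq val_inj).
    move=> /orP[/eqP /= xa|xB]; first by have := in2 _ _ CQ xC; lia.
    by move: CB; rewrite (inB _ _ CQ xC xB) eqxx.
  + by move=> /(in2 _ _ CQ) ? /(in1 _ _ DQ); lia.
  + exact: triv2.
- move=> x y z t xy yz zt; rewrite !same_block_prepend !in_setU1 -!(inj_eq val_inj) /=.
  have gt_a (u v : 'I_n) : (u < v)%N -> (u == a :> nat) || (u \in block_of Q2 d) ->
      (v == a :> nat) || (v \in block_of Q2 d) -> v \in block_of Q2 d.
    move=> uv /orP[/eqP ua|/domB ud] /orP[/eqP va|//]; lia.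
  case/or3P=> [xz|xz|/andP[xb zb]]; case/or3P=> [yt|yt|/andP[yb tb]].
  + by rewrite (nc1 x y z t).
  + by have := dom1 _ _ xz; have := dom2 _ _ yt; clear -xy yz zt ad db; lia.
  + have := dom1 _ _ xz; have := domB _ (gt_a _ _ (ltn_trans yz zt) yb tb).
    by case/orP: yb => [/eqP/=|/domB]; clear -xy yz zt ad db; lia.
  + by have := dom2 _ _ xz; have := dom1 _ _ yt; clear -xy yz zt ad db; lia.
  + by rewrite (nc2 x y z t) ?orbT.
  + have tB := gt_a _ _ (ltn_trans yz zt) yb tb.
    case/orP: yb => [/eqP ya|yB]; first by have := dom2 _ _ xz; clear -xy ya ad; lia.
    by rewrite (nc2 x y z t) ?orbT // sameB.
  + have := dom1 _ _ yt; have := domB _ (gt_a _ _ (ltn_trans xy yz) xb zb).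
    by clear -xy yz zt ad db; lia.
  + have zB := gt_a _ _ (ltn_trans xy yz) xb zb.
    suff -> : y \in block_of Q2 d by rewrite xb !orbT.
    case/orP: xb => [_|xB]; last first.
      rewrite (block_of_same _ _ _ _ _ ncQ2 xB).
      by apply: (nc2 x y z t) => //; apply: sameB.
    (* Here [x] is [a]; the point [d] of the same block takes its place, unless [y] is [d]
       itself. *)
    have [d' d'd d'z] := block_ofP _ _ _ zB.
    apply/block_ofP; exists d' => //.
    have [yd|yd] := eqVneq (y : nat) d.
      have -> : y = d' by apply: val_inj; rewrite /= d'd.
      by apply: (same_block_trans _ _ _ _ _ ncQ2 d'z); rewrite same_block_sym.
    apply: (nc2 d' y z t) => //; have := dom2 _ _ yt.
    by clear -d'd yd; lia.
  + by rewrite xb yb !orbT.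
Qed.

Lemma restr_prepend1 : restr (prepend a d Q1 Q2) (itv a.+1 d) = Q1.
Proof.
apply: (ncpart_eq _ _ _ _ ncQ1).
  apply: ncpart_restr ncpart_prepend; apply/fintype.subsetP => x; rewrite !inE; lia.
move=> x y; rewrite same_block_restr same_block_prepend.
apply/and3P/idP => [[/or3P[//|/dom2|/andP[]]]|xy].
- rewrite !inE; lia.
- by rewrite in_setU1 => /orP[/eqP->|/domB xd] _; rewrite inE; lia.
- by rewrite xy; have := dom1 _ _ xy; rewrite !inE => /andP[].
Qed.

Lemma restr_prepend2 : restr (prepend a d Q1 Q2) (itv d b) = Q2.
Proof.
apply: (ncpart_eq _ _ _ _ ncQ2).
  apply: ncpart_restr ncpart_prepend; apply/fintype.subsetP => x; rewrite !inE; lia.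
move=> x y; rewrite same_block_restr same_block_prepend.
apply/and3P/idP => [[/or3P[/dom1|//|/andP[]]]|xy].
- rewrite !inE; lia.
- rewrite !in_setU1 => /orP[/eqP->|xB] /orP[/eqP->|yB]; rewrite ?inE; try lia.
  by rewrite -(block_of_same _ _ _ _ _ ncQ2 xB).
- by rewrite xy orbT; have := dom2 _ _ xy; rewrite !inE => /andP[].
Qed.

Lemma is_next_prepend : (b <= n)%N -> is_next (prepend a d Q1 Q2) d.
Proof.
move=> bn; split=> [x|lt_db].
  rewrite -block_of_ord block_of_prepend in_setU1 => /orP[->//|/domB]; lia.
have dn : (d < n)%N by apply: leq_trans lt_db bn.
exists (Ordinal dn) => //; rewrite -block_of_ord block_of_prepend in_setU1.
apply/orP; right; apply/block_ofP; exists (Ordinal dn) => //.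
by have [_ <- _ _] := ncpartP _ _ ncQ2; rewrite inE /= leqnn.
Qed.

End PrependLemmas.

(** A block other than that of [a] that met both sides of [d] would cross it at the pair [a], [d],
    so the cut loses nothing. The rest of the block of [a] starts at [d], or is empty when
    [d = b]. *)
Lemma prepend_restr P d : (a < d)%N -> (d <= b)%N -> ncpart (itv a b) P ->
  is_next P d -> prepend a d (restr P (itv a.+1 d)) (restr P (itv d b)) = P.
Proof.
move=> ad db ncP [nextP nextd].
have [_ PS _ ncc] := ncpartP _ _ ncP.
have tr x y z := same_block_trans _ _ x y z ncP.
have dom x y : same_block P x y -> (a <= x < b)%N && (a <= y < b)%N.
  by move=> /(same_block_dom _ _ _ _ ncP); rewrite !inE.
have nc1 : ncpart (itv a.+1 d) (restr P (itv a.+1 d)).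
  apply: ncpart_restr ncP; apply/fintype.subsetP => x; rewrite !inE; lia.
have nc2 : ncpart (itv d b) (restr P (itv d b)).
  apply: ncpart_restr ncP; apply/fintype.subsetP => x; rewrite !inE; lia.
apply: (ncpart_eq _ _ _ (ncpart_prepend _ _ _ ad db nc1 nc2) ncP) => x y.
have aa : same_block P a a by rewrite -PS inE; lia.
have bigE z : (z \in a |: block_of (restr P (itv d b)) d) = same_block P a z.
  rewrite in_setU1; apply/orP/idP => [[/eqP->//|/block_ofP[d' d'd]]|az].
    rewrite same_block_restr !inE => /and3P[d'z _ /andP[dz zb]].
    have [|d'' d''d ad''] := nextd; first lia.
    apply: tr d'z; rewrite (_ : d' = d'') //; apply: val_inj; rewrite /= d'd.
    by rewrite d''d.
  have [|za] := eqVneq z a; [by left|right].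
  have dz := nextP z az za; have zb := dom _ _ az.
  have [|d' d'd ad'] := nextd; first lia.
  apply/block_ofP; exists d' => //; rewrite same_block_restr !inE.
  rewrite (tr d' a z) //; last by rewrite same_block_sym.
  by apply/andP; split; lia.
rewrite same_block_prepend !same_block_restr !bigE.
apply/or3P/idP => [[/and3P[]//|/and3P[]//|/andP[ax ay]]|xy].
  by apply: tr ay; rewrite same_block_sym.
have [ax|nax] := boolP (same_block P a x); first by apply: Or33; rewrite (tr a x y).
have nay : ~~ same_block P a y.
  by apply: contra nax => ay; apply: tr ay _; rewrite same_block_sym.
have xa : x != a :> nat by apply: contraNneq nax => /val_inj->.
have ya : y != a :> nat by apply: contraNneq nay => /val_inj->.
have cross z t : same_block P z t -> ~~ same_block P a z -> ~~ same_block P a t ->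
    z != a :> nat -> (z < d)%N -> (d <= t)%N -> False.
  move=> zt naz nat_ za zd dt; have dz := dom _ _ zt.
  have [|d' d'd ad'] := nextd; first by clear -dt dz; lia.
  have td : t != d :> nat.
    apply: contraNneq nat_ => td; rewrite (_ : t = d') //.
    by apply: val_inj; rewrite /= d'd.
  by move/negP: naz; apply; apply: (ncc a z d' t) => //; clear -za zd dt td d'd dz; lia.
have dx := dom _ _ xy.
have [xd|dx'] := ltnP x d; have [yd|dy'] := ltnP y d.
- by apply: Or31; rewrite xy !inE; apply/and3P; split=> //; lia.
- by case: (cross x y).
- by case: (cross y x) => //; rewrite same_block_sym.
- by apply: Or32; rewrite xy !inE; apply/and3P; split=> //; lia.
Qed.

End Prepend.
End Noncrossing.

(** * The successor of the first element in its block *)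

Section Successor.
Context {n : nat}.
Implicit Types (P : {set {set 'I_n}}) (a x : 'I_n).

(** [find] returns the length of the list when nothing is found: for [a < b], if [a] ends its block,
    then [a.+1 + next_gap a b P] is [b], the convention of [is_next]. *)
Definition next_gap a (b : nat) P : nat :=
  find (fun i => [exists x : 'I_n, (x == a.+1 + i :> nat)%N && same_block P a x])
    (iota 0 (b - a.+1)).

Lemma next_gap_le a b P : (next_gap a b P <= b - a.+1)%N.
Proof. by rewrite -[leqRHS](size_iota 0); apply: find_size. Qed.

Lemma is_next_gap a b P : ncpart (itv a b) P ->
  is_next a b P (a.+1 + next_gap a b P)%N.
Proof.
move=> ncP; rewrite /next_gap; set p := fun i => [exists _, _].
split=> [x ax xa|lt].
  rewrite leqNgt; apply/negP => lt.
  have := same_block_dom _ _ _ _ ncP ax; rewrite !inE => /andP[_ /andP[le_ax xb]].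
  have xa' : x != a :> nat by apply: contraNneq xa => /val_inj->.
  have ltf : (x - a.+1 < find p (iota 0 (b - a.+1)))%N by lia.
  have := before_find 0%N ltf; rewrite nth_iota; last lia.
  move/negbT/negP; apply; rewrite /p; apply/existsP; exists x; rewrite ax andbT; lia.
have ltf : (find p (iota 0 (b - a.+1)) < b - a.+1)%N by lia.
have hasp : has p (iota 0 (b - a.+1)) by rewrite has_find size_iota.
have := nth_find 0%N hasp; rewrite nth_iota //.
by rewrite add0n /p => /existsP[x /andP[/eqP xE ax]]; exists x.
Qed.

End Successor.

(** * Sums over non-crossing partitions with one block left open *)

Section BlockExpansion.
Context {K : comNzRingType}.
Variables (r : word -> K) (w : word).
Local Notation n := (size w).
Implicit Types (P Q : {set {set 'I_n}}) (B : {set 'I_n}) (u v : word).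

Definition partw P : K := \prod_(B in P) r (subword B).

Definition nc_sum (a b : nat) : K := \sum_(P | ncpart (itv a b) P) partw P.

(* The block of d is completed on the left by the letters of u. *)
Definition open_partw u d P : K :=
  r (u ++ subword (block_of P d)) * \prod_(B in P :\ block_of P d) r (subword B).

Definition open_nc_sum u (d b : nat) : K :=
  \sum_(P | ncpart (itv d b) P) open_partw u d P.

Lemma itv_id b : itv b b = finset.set0 :> {set 'I_n}.
Proof. by apply/setP => x; rewrite !inE; lia. Qed.

Lemma nc_sum_id b : nc_sum b b = 1.
Proof.
rewrite /nc_sum itv_id (eq_bigl _ _ (@ncpart_set0 n)) big_pred1_eq.
by rewrite /partw big_set0.
Qed.

Lemma subword0 : subword (finset.set0 : {set 'I_n}) = [::].
Proof. by rewrite /subword enum_set0. Qed.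

(** No position is left, so the open block is closed as [u]. *)
Lemma open_nc_sum_id u b : open_nc_sum u b b = r u.
Proof.
rewrite /open_nc_sum itv_id (eq_bigl _ _ (@ncpart_set0 n)) big_pred1_eq.
have B0 : block_of (finset.set0 : {set {set 'I_n}}) b = finset.set0.
  apply/setP => y; rewrite finset.in_set0; apply/block_ofP => -[x _ /same_blockP[C []]].
  by rewrite inE.
rewrite /open_partw B0 subword0 cats0 big1 ?mulr1 // => B.
by rewrite !inE andbF.
Qed.

Lemma nc_sum_open (a b : nat) : (a < b <= n)%N ->
  nc_sum a b = open_nc_sum [::] a b.
Proof.
move=> /andP[ab bn]; apply: eq_bigr => P ncP.
have an : (a < n)%N by apply: leq_trans bn.
rewrite /partw (big_setD1 (block_of P a)) //=.
apply: (@block_of_mem _ (itv a b) P (Ordinal an)) => //.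
by rewrite inE leqnn.
Qed.

(** [enum] lists positions increasingly, and two strictly sorted lists with the same members are
    equal. *)
Lemma subword_cons (a : 'I_n) B : (forall x, x \in B -> (a < x)%N) ->
  subword (a |: B) = tnth (in_tuple w) a :: subword B.
Proof.
move=> aB; rewrite /subword -map_cons; congr map.
pose lt := relpre (@nat_of_ord n) ltn.
have lt_tr : transitive lt by move=> y x z /=; apply: ltn_trans.
have srt C : sorted lt (enum C).
  rewrite /enum_mem; apply: sorted_filter => //.
  by rewrite -enumT /lt -sorted_map val_enum_ord iota_ltn_sorted.
apply: (irr_sorted_eq lt_tr) => [x|||x]; rewrite /= ?ltnn ?srt //.
  rewrite (path_sortedE lt_tr) srt andbT; apply/allP => x.
  by rewrite mem_enum; apply: aB.
by rewrite inE !mem_enum in_setU1.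
Qed.

(** The open block reads the letter of [a] and then the block of [d], so this letter passes to [u].
    Blocks of [Q1] and [Q2] are nonempty with disjoint supports, hence distinct, and the product
    splits. *)
Lemma open_partw_prepend u (a : 'I_n) (b d : nat) Q1 Q2 : (a < d)%N -> (d <= b)%N ->
  ncpart (itv a.+1 d) Q1 -> ncpart (itv d b) Q2 ->
  open_partw u a (prepend a d Q1 Q2) =
    partw Q1 * open_partw (rcons u (tnth (in_tuple w) a)) d Q2.
Proof.
move=> ad db ncQ1 ncQ2.
have dom2 C x : C \in Q2 -> x \in C -> (d <= x)%N.
  move=> CQ xC; have [_ /(_ x)] := ncpartP _ _ ncQ2.
  rewrite inE => /esym E _ _; suff : same_block Q2 x x by rewrite E => /andP[].
  by apply/same_blockP; exists C.
have dom1 C x : C \in Q1 -> x \in C -> (a < x < d)%N.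
  move=> CQ xC; have [_ /(_ x)] := ncpartP _ _ ncQ1.
  rewrite inE => /esym E _ _; suff : same_block Q1 x x by rewrite E.
  by apply/same_blockP; exists C.
have domB x : x \in block_of Q2 d -> (d <= x)%N.
  by move=> /block_ofP[y _ /same_blockP[C [CQ _ /(dom2 C)->]]].
rewrite /open_partw (block_of_prepend a b) //.
rewrite subword_cons; last by move=> x /domB; apply: leq_trans.
rewrite -cat_rcons mulrCA; congr (_ * _).
have -> : prepend a d Q1 Q2 :\ (a |: block_of Q2 d) = Q1 :|: Q2 :\ block_of Q2 d.
  rewrite /prepend setU1K // finset.in_setU in_setD1 negb_or.
  have aB : a \in a |: block_of Q2 d by rewrite in_setU1 eqxx.
  apply/andP; split; first by apply/negP => /dom1/(_ aB); rewrite ltnn.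
  by apply/negP => /andP[_ /dom2/(_ aB)]; rewrite leqNgt ad.
rewrite -bigU /=.
  by apply: eq_bigl => C; rewrite finset.in_setU.
rewrite finset.disjoints_subset; apply/fintype.subsetP => C CQ1.
rewrite inE in_setD1 negb_and; apply/orP; right; apply/negP => CQ2.
have [/(_ C CQ1)/finset.set0Pn[x xC] _ _ _] := ncpartP _ _ ncQ1.
by have := dom1 _ _ CQ1 xC; have := dom2 _ _ CQ2 xC; lia.
Qed.

(** A partition amounts to the length [i] of the gap after [a], a partition of the gap, and a
    partition of what follows, where the open block continues. At the last value of [i] the open
    block ends with [a]. *)
Lemma open_nc_sum_rec u (a : 'I_n) (b : nat) : (a < b <= n)%N ->
  open_nc_sum u a b = \sum_(0 <= i < (b - a.+1).+1)
    nc_sum a.+1 (a.+1 + i) *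
    open_nc_sum (rcons u (tnth (in_tuple w) a)) (a.+1 + i) b.
Proof.
move=> /andP[ab bn]; set c := tnth _ a.
pose h (t : 'I_(b - a.+1).+1 * ({set {set 'I_n}} * {set {set 'I_n}})) :=
  prepend a (a.+1 + t.1) t.2.1 t.2.2.
pose k P : 'I_(b - a.+1).+1 * ({set {set 'I_n}} * {set {set 'I_n}}) :=
  let i : 'I_(b - a.+1).+1 := inord (next_gap a b P) in
  (i, (restr P (itv a.+1 (a.+1 + i)), restr P (itv (a.+1 + i) b))).
have hk P : ncpart (itv a b) P -> h (k P) = P.
  move=> ncP; have le_i := next_gap_le a b P; have nextP := is_next_gap _ _ _ ncP.
  rewrite /h /k /= inordK ?ltnS //; apply: prepend_restr ncP nextP; lia.
(* [h] glues and [k] cuts. The new sum ranges over the triples that [k] recovers after [h]; they are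
   those made of two non-crossing partitions of the right intervals. *)
rewrite /open_nc_sum (reindex_onto h k) //.
rewrite big_mkord.
transitivity (\sum_(t : 'I_(b - a.+1).+1 * ({set {set 'I_n}} * {set {set 'I_n}})
    | ncpart (itv a.+1 (a.+1 + t.1)) t.2.1 && ncpart (itv (a.+1 + t.1) b) t.2.2)
    partw t.2.1 * open_partw (rcons u c) (a.+1 + t.1) t.2.2).
  have le_d (i : 'I_(b - a.+1).+1) : (a.+1 + i <= b)%N by have := ltn_ord i; lia.
  have lt_d (i : 'I_(b - a.+1).+1) : (a < a.+1 + i)%N by lia.
  apply: eq_big => [[i [Q1 Q2]]|[i [Q1 Q2]]] /=; rewrite /h /=.
    apply/andP/andP => [[ncP /eqP[iE Q1E Q2E]]|[nc1 nc2]].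
      rewrite iE in Q1E Q2E.
      split; [rewrite -Q1E|rewrite -Q2E]; apply: ncpart_restr ncP;
        apply/fintype.subsetP => x; rewrite !inE; have := le_d i; lia.
    have ncP := ncpart_prepend _ _ _ _ _ (lt_d i) (le_d i) nc1 nc2.
    split=> //; apply/eqP; rewrite /k.
    (* In the glued partition [a.+1 + i] is a successor of [a]; successors being unique, the cut
       finds the same [i]. *)
    have -> : inord (next_gap a b (prepend a (a.+1 + i) Q1 Q2)) = i.
      apply: val_inj; rewrite /= inordK ?ltnS ?next_gap_le //.
      apply/eqP; rewrite -(eqn_add2l a.+1); apply/eqP.
      have le_g := next_gap_le a b (prepend a (a.+1 + i) Q1 Q2).
      apply: (is_next_uniq a b _ _ _ _ _ (is_next_gap _ _ _ ncP)
        (is_next_prepend _ _ _ _ _ (lt_d i) (le_d i) nc1 nc2 bn)); have := le_d i; lia.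
    by rewrite (restr_prepend1 _ b) // (restr_prepend2 _ b).
  case/andP=> ncP /eqP[iE Q1E Q2E]; rewrite iE in Q1E Q2E.
  apply: (open_partw_prepend _ _ b) => //; [rewrite -Q1E|rewrite -Q2E];
    apply: ncpart_restr ncP; apply/fintype.subsetP => x; rewrite !inE;
    have := le_d i; lia.
rewrite -(pair_big_dep xpredT (fun (i : 'I_(b - a.+1).+1) q =>
    ncpart (itv a.+1 (a.+1 + i)) q.1 && ncpart (itv (a.+1 + i) b) q.2)
  (fun (i : 'I_(b - a.+1).+1) q =>
    partw q.1 * open_partw (rcons u c) (a.+1 + i) q.2)) /=.
apply: eq_bigr => i _.
rewrite -(pair_big_dep (ncpart (itv a.+1 (a.+1 + i)))
  (fun _ => ncpart (itv (a.+1 + i) b))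
  (fun Q1 Q2 => partw Q1 * open_partw (rcons u c) (a.+1 + i) Q2)) /=.
rewrite /nc_sum mulr_suml; apply: eq_bigr => Q1 _.
by rewrite mulr_sumr.
Qed.

End BlockExpansion.

(** * The moment-cumulant formula expanded along the first block *)

Section FirstBlock.
Context {K : comNzRingType}.
Implicit Types (u v w : word) (M r : word -> K).

Lemma nc_sumT r w : nc_sum r w 0 (size w) =
  \sum_(P in NC (size w)) \prod_(B in P) r (subword B).
Proof.
apply: eq_bigl => P; rewrite inE; congr (finset.partition _ _ && _).
by apply/setP => x; rewrite !inE ltn_ord.
Qed.

(* G u w sums over the non-crossing partitions of w, the block of the first
   letter being completed on the left by u: this letter joins u, then a word
   take i w is skipped up to the next letter of its block. *)
Lemma first_block_expansion M r : M [::] = 0 -> is_nc_R_series M r ->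
  exists G : word -> word -> K,
    [/\ forall u, G u [::] = r u,
        forall u c w, G u (c :: w) = ncs_mul (ncs_onep M) (G (rcons u c)) w
      & forall w, M w = G [::] w].
Proof.
move=> M0 [r0 Mr].
(* The factor of the skipped word is expressed through [H] itself, with value 1 at the empty word,
   which closes the recursion on the length of the second word; [mM] identifies this factor with
   [1 + M]. *)
pose F (H : word * word -> K) (p : word * word) : K := if p.2 is c :: v then
  ncs_mul (fun x => if x is [::] then 1 else H ([::], x))
    (fun x => H (rcons p.1 c, x)) v else r p.1.
have [H1 H2 [u [|c v]] HH //=|H HF] := @local_fixpoint K _ (fun p => size p.2) F.
  rewrite /F /=; apply: eq_bigr => i _; congr (_ * _).
    case E : (take i v) => [//|x y]; apply: HH => /=.
    by rewrite -[(size y).+1]/(size (x :: y)) -E ltnS size_take_min geq_minr.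
  by apply: HH; rewrite /= ltnS size_drop leq_subr.
pose G u v := H (u, v); pose m v := if v is [::] then 1 else G [::] v.
have Gnil u : G u [::] = r u by rewrite /G HF.
have Gcons u c w : G u (c :: w) = ncs_mul m (G (rcons u c)) w by rewrite {1}/G HF.
(* Both identities go together by induction on [b - a], since the recursion for open sums involves
   the closed sums over the gaps. *)
have sumE w a b : (a <= b <= size w)%N ->
    nc_sum r w a b = m (drop a (take b w)) /\
    forall u, open_nc_sum r w u a b = G u (drop a (take b w)).
  have [k] := ubnP (b - a)%N; elim: k a b => // k IHk a b lt_k /andP[le_ab le_bw].
  have [ba|ab] := leqP b a.
    have -> : a = b by apply/eqP; rewrite eqn_leq le_ab.
    rewrite drop_oversize ?size_takel //.
    by split=> [|u]; rewrite ?nc_sum_id ?open_nc_sum_id ?Gnil.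
  have aw : (a < size w)%N by apply: leq_trans le_bw.
  have -> : drop a (take b w) =
      tnth (in_tuple w) (Ordinal aw) :: drop a.+1 (take b w).
    rewrite (drop_nth true) ?size_takel // nth_take //; congr (_ :: _).
    by rewrite (tnth_nth true).
  suff openE u : open_nc_sum r w u a b =
      G u (tnth (in_tuple w) (Ordinal aw) :: drop a.+1 (take b w)).
    by split=> //; rewrite nc_sum_open ?ab ?openE.
  rewrite (@open_nc_sum_rec _ r w u (Ordinal aw) b) ?ab // Gcons.
  rewrite /ncs_mul -(big_mkord xpredT (fun i => m (take i _) * G _ (drop i _))).
  rewrite size_drop size_takel //.
  rewrite !big_nat; apply: eq_bigr => i /andP[_ /= lt_i] /=.
  rewrite take_drop drop_drop [(i + _)%N]addnC take_takel; last lia.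
  have [||<- _] := IHk a.+1 (a.+1 + i)%N; [lia|lia|].
  have [||_ <-] := IHk (a.+1 + i)%N b; [lia|lia|].
  by [].
(* On the whole word the closed sum is the right-hand side of the moment-cumulant formula. *)
have mM w : m w = ncs_onep M w.
  case: w => [|c w]; first by rewrite /ncs_onep M0 addr0.
  rewrite /ncs_onep add0r Mr // -nc_sumT.
  by have [|-> _] := sumE (c :: w) 0%N (size (c :: w)); rewrite ?leqnn ?take_size.
exists G; split=> [//|u c w|[|c w]].
- by rewrite Gcons; congr ncs_mul; apply/funext.
- by rewrite Gnil r0.
- by have := mM (c :: w); rewrite /ncs_onep add0r => <-.
Qed.

End FirstBlock.

(** * Series restricted to alternating words *)

Section AlternatingWords.
Context {K : comNzRingType}.
Implicit Types (u v w : word) (c : bool) (M r : word -> K).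

(** Odd lengths are included because cutting an alternating word produces them; position [i] carries
    the letter [c (+) odd i]. *)
Definition altw c k : word := traject negb c k.

Lemma altwS c k : altw c k.+1 = c :: altw (~~ c) k.
Proof. by []. Qed.

Lemma size_altw c k : size (altw c k) = k.
Proof. exact: size_traject. Qed.

Lemma take_altw c k i : (i <= k)%N -> take i (altw c k) = altw c i.
Proof. exact: take_traject. Qed.

Lemma drop_altw c k i : drop i (altw c k) = altw (c (+) odd i) (k - i).
Proof.
elim: k i c => [|k IHk] [|i] c; rewrite ?addbF //=.
by rewrite IHk subSS addNb addbN.
Qed.

Lemma rcons_altw c k : rcons (altw c k) (c (+) odd k) = altw c k.+1.
Proof.
by elim: k c => [|k IHk] c; rewrite /= ?addbF // addbN -addNb IHk.
Qed.

Lemma altw_sorted c k : sorted (frel negb) (altw c k).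
Proof. by case: k => // k; exact: fpath_traject. Qed.

Lemma evalw_altw (A : pzSemiRingType) (x xs : A) c n :
  evalw x xs (altw c n.*2) = (if c then xs * x else x * xs) ^+ n.
Proof.
elim: n => [|n IHn]; first by rewrite /evalw big_nil expr0.
rewrite doubleS !altwS negbK exprS -IHn /evalw !big_cons mulrA.
by case: c {IHn}.
Qed.

Lemma alternating_altw w : Defs.alternating w -> exists c m, w = altw c m.*2.
Proof.
move=> [m _ wE]; suff E c : flatten (nseq m [:: c; ~~ c]) = altw c m.*2.
  case: wE => ->; first by exists false, m; exact: (E false).
  by exists true, m; exact: (E true).
by elim: m {wE} => // m IHm; rewrite doubleS !altwS negbK /= IHm.
Qed.

(** The case [m = 0] leaves the value at the empty word free. *)
Definition alt_supported r : Prop :=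
  forall w, (forall c m, w <> altw c m.*2) -> r w = 0.

Lemma alt_supported_odd r w : alt_supported r -> odd (size w) -> r w = 0.
Proof. by move=> sr ow; apply: sr => c m E; rewrite E size_altw odd_double in ow. Qed.

Lemma alt_supported_sorted r w : alt_supported r ->
  ~~ sorted (frel negb) w -> r w = 0.
Proof. by move=> sr; move=> sw; apply: sr => c m E; rewrite E altw_sorted in sw. Qed.

(** On the moment series of a distribution this gives the moment series of [Zvar * Zstar] when [c]
    is [false], and of [Zstar * Zvar] when [c] is [true]. *)
Definition alt_coef c r : nat -> K := fun n => r (altw c n.*2).

Lemma alt_coef_onep c M : alt_coef c (ncs_onep M) = fps_onep (alt_coef c M).
Proof. by apply/funext => -[|n]. Qed.

Lemma sum_even (F : nat -> K) n : (forall j, (j < n)%N -> F j.*2.+1 = 0) ->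
  \sum_(i < n.*2) F i = \sum_(j < n) F j.*2.
Proof.
elim: n => [|n IHn] F0; first by rewrite !big_ord0.
rewrite doubleS !big_ord_recr /= F0 // addr0 IHn // => j lt_jn.
by apply: F0; apply: ltnW.
Qed.

(** An odd cut hands [e] a word of odd length, where it vanishes; an even cut leaves a suffix that
    starts with [c] again. *)
Lemma alt_coef_mul c e M : alt_supported e ->
  alt_coef c (ncs_mul e M) = fps_mul (alt_coef c e) (alt_coef c M).
Proof.
move=> se; apply/funext => n; rewrite /alt_coef /ncs_mul size_altw.
transitivity (\sum_(i < n.*2.+1) e (altw c i) * M (altw (c (+) odd i) (n.*2 - i))).
  by apply: eq_bigr => i _; rewrite drop_altw take_altw // -ltnS.
rewrite big_ord_recr (sum_even (fun i =>
    e (altw c i) * M (altw (c (+) odd i) (n.*2 - i)))) /=.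
  rewrite /fps_mul big_ord_recr /= odd_double addbF !subnn; congr (_ + _).
  by apply: eq_bigr => j _; rewrite odd_double addbF doubleB.
move=> j _; rewrite (alt_supported_odd e (altw c j.*2.+1) se) ?mul0r //.
by rewrite size_altw /= odd_double.
Qed.

(** [E p] stands for the tail f_p + f_{p+1} y + ...; the hypothesis is Horner's rule, which
    determines all the tails because [y] has no constant term. *)
Lemma fps_comp_uniq (f y : nat -> K) (E : nat -> nat -> K) : y 0%N = 0 ->
  (forall p n, E p n = f p * (n == 0%N)%:R + fps_mul y (E p.+1) n) ->
  E 0%N = fps_comp f y.
Proof.
move=> y0 Erec; apply/funext => n.
suff E_comp p : E p n = fps_comp (fun k => f (p + k)%N) y n by apply: E_comp.
elim/ltn_ind: n p => n IHn p; rewrite Erec fps_comp_recl // addn0; congr (_ + _).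
apply: eq_fps_mul0 => // i lt_in; rewrite IHn //.
by congr (fps_comp _ y i); apply/funext => k; rewrite addnS.
Qed.

Section Functional.
Variables (M r : word -> K) (G : word -> word -> K).
Hypothesis r_supp : alt_supported r.
Hypothesis G_nil : forall u, G u [::] = r u.
Hypothesis G_cons : forall u c w,
  G u (c :: w) = ncs_mul (ncs_onep M) (G (rcons u c)) w.
Hypothesis M_G : forall w, M w = G [::] w.

(** The expansion only appends letters to [u], so [G u v] is a combination of values of [r] at words
    beginning with [u]. *)
Lemma expansion_eq0 u v : (forall w, r (u ++ w) = 0) -> G u v = 0.
Proof.
have [k] := ubnP (size v); elim: k u v => // k IHk u [|c v] lt_v ru0.
  by rewrite G_nil -[u]cats0.
rewrite G_cons /ncs_mul big1 // => i _; rewrite IHk ?mulr0 //.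
  by rewrite size_drop; rewrite ltnS in lt_v; apply: leq_ltn_trans (leq_subr _ _) lt_v.
by move=> w; rewrite cat_rcons.
Qed.

(** The open block has read [l] letters, and the [k] remaining ones continue the alternation. *)
Let H c l k := G (altw c l) (altw (c (+) odd l) k).

(** After a skipped word of odd length, the block would either repeat its last letter or end with an
    odd length; the support of [r] excludes both. The skipped words of even length remain. *)
Lemma expansion_rec c l k : ~~ odd (l + k.+1) ->
  H c l k.+1 = \sum_(0 <= j < k./2.+1)
    alt_coef (c (+) odd l.+1) (ncs_onep M) j * H c l.+1 (k - j.*2).
Proof.
move=> even_lk; rewrite /H altwS G_cons rcons_altw -addbN /ncs_mul size_altw.
set F := fun i => ncs_onep M (altw (c (+) odd l.+1) i) *
  G (altw c l.+1) (altw (c (+) odd l.+1 (+) odd i) (k - i)).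
transitivity (\sum_(i < k.+1) F i).
  by apply: eq_bigr => i _; rewrite drop_altw take_altw // -ltnS.
have F0 j : (j.*2.+1 <= k)%N -> F j.*2.+1 = 0.
  move=> le_jk; rewrite /F; set c' := _ (+) odd j.*2.+1.
  suff -> : G (altw c l.+1) (altw c' (k - j.*2.+1)) = 0 by rewrite mulr0.
  have c'E : c' = c (+) odd l.
    by rewrite /c' /= odd_double addbT addbN negbK.
  case kE : (k - j.*2.+1)%N => [|k'].
    rewrite G_nil (alt_supported_odd r) // size_altw.
    have kj : k = j.*2.+1 by apply/eqP; rewrite eqn_leq le_jk -subn_eq0 kE.
    by move: even_lk; rewrite kj oddD /= odd_double addbF.
  rewrite (altwS c') G_cons /ncs_mul big1 // => i _.
  rewrite expansion_eq0 ?mulr0 // => w.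
  (* The last letter read and the next letter of the block are both [c (+) odd l]. *)
  apply: alt_supported_sorted => //.
  rewrite -rcons_altw c'E !cat_rcons; apply/negP => /cat_sorted2[_] /=.
  by case: (c (+) _).
transitivity (\sum_(0 <= j < k./2.+1) F j.*2); last first.
  rewrite !big_nat; apply: eq_bigr => j _.
  by rewrite /F /H odd_double addbF.
(* For odd [k] the [k.+1] indices pair up; for even [k] the last index is even and is kept apart. *)
rewrite -(big_mkord xpredT F) -{1}[k]odd_double_half; case: (boolP (odd k)) => ok.
  rewrite add1n -doubleS !big_mkord sum_even // => j lt_j; apply: F0.
  by rewrite -[k]odd_double_half ok add1n ltnS leq_double.
rewrite add0n !big_mkord !big_ord_recr sum_even // => j lt_j; apply: F0.
by rewrite -[k]odd_double_half (negPf ok) add0n ltn_double.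
Qed.

(** Each pair of letters of the block brings two gaps, one starting with [~~ c] and one with [c],
    hence one factor of the inner series. Horner's rule then sums over the length of the block. *)
Lemma alt_coef_expansion c : alt_coef c M =
  fps_comp (alt_coef c r) (fps_mulX (fps_mul
    (fps_onep (alt_coef (~~ c) M)) (fps_onep (alt_coef c M)))).
Proof.
rewrite -!alt_coef_onep.
set A := alt_coef c (ncs_onep M); set A' := alt_coef (~~ c) (ncs_onep M).
(* [p] pairs of letters are in the block and [n] pairs remain. *)
pose E p n := H c p.*2 n.*2.
have -> : alt_coef c M = E 0%N.
  by apply/funext => n; rewrite /E /H /= addbF; apply: M_G.
apply: fps_comp_uniq => // p [|n]; first by rewrite /E /H G_nil mulr1 fps_mulXl addr0.
rewrite mulr0 add0r fps_mulXl -fps_mulA /=.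
have EO : E p n.+1 = fps_mul A' (fun i => H c p.*2.+1 i.*2.+1) n.
  rewrite /E doubleS expansion_rec; last by rewrite oddD /= !odd_double.
  rewrite /= uphalf_double odd_double addbT big_mkord; apply: eq_bigr => i _.
  by rewrite subSn ?doubleB // leq_double -ltnS.
rewrite EO; apply: eq_fps_mul => // i _.
rewrite expansion_rec; last by rewrite oddD /= !odd_double.
rewrite /= doubleK odd_double addbF big_mkord.
by apply: eq_bigr => j _; rewrite -doubleB -doubleS.
Qed.

End Functional.
End AlternatingWords.

(** * The R- and eta-series along alternating words *)

Section OneVariableOfTwo.
Context {K : comNzRingType}.
Implicit Types (c : bool) (M r : word -> K).

Lemma alt_coef_R_series c M : M [::] = 0 -> alt_supported (nc_R_series M) ->
  let r := nc_R_series M in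
  alt_coef c M = fps_comp (alt_coef c r) (fps_mulX (fps_mul
    (fps_onep (alt_coef (~~ c) M)) (fps_onep (alt_coef c M)))).
Proof.
move=> M0 r_supp r.
have [G [G_nil G_cons M_G]] := first_block_expansion _ _ M0 (nc_R_seriesP M).
exact: alt_coef_expansion r_supp G_nil G_cons M_G c.
Qed.

(** The relation M = eta (1 + M) restricts to alternating words, the support of eta making the
    restriction multiplicative, and it characterizes the one-variable eta-series. *)
Lemma alt_coef_eta_series c M : M [::] = 0 -> alt_supported (nc_eta_series M) ->
  eta_series (alt_coef c M) = alt_coef c (nc_eta_series M).
Proof.
move=> M0 eta_supp; apply: eta_series_uniq => //.
rewrite -alt_coef_onep -alt_coef_mul //; congr alt_coef.
rewrite /nc_eta_series -ncs_mulA.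
have [|_ ->] := @ncs_invP _ (ncs_onep M); first by rewrite /ncs_onep M0 addr0.
by rewrite ncs_mul1r.
Qed.

End OneVariableOfTwo.

(** * Moments of [Zvar * Zstar] and [Zstar * Zvar] *)

Section Moments.
Context {R : realType}.
Implicit Types (mu : {scalar ncpoly R[i]}).

Lemma nc_M_nil mu : nc_M mu [::] = 0.
Proof. by []. Qed.

Lemma alt_coef_nc_M mu c : alt_coef c (nc_M mu) =
  elt_moment_series mu (if c then Zstar * Zvar else Zvar * Zstar).
Proof.
apply/funext => -[|n] //.
by rewrite /alt_coef /nc_M /nc_moment_series evalw_altw.
Qed.

Lemma eta_diagonal_supported mu : eta_diagonal mu -> alt_supported (nc_eta mu).
Proof.
move=> eta_mu w nalt; apply: eta_mu => [|/alternating_altw[c [m wE]]].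
  by apply/eqP => w0; apply: (nalt true 0%N).
exact: nalt wE.
Qed.

End Moments.

Theorem theorem6p4 (R : realType)
  (sigma1 sigma2 tau1 tau2 : probability (measurableTypeR R) R)
  (nu : {scalar ncpoly R[i]})
  (hsigma1 : Pc_plus sigma1) (hsigma2 : Pc_plus sigma2)
  (htau1 : is_B sigma1 tau1) (htau2 : is_B sigma2 tau2)
  (hnu : is_Psi sigma1 sigma2 nu) :
  elt_R_series nu (Zvar * Zstar)
    = fps_comp (R_meas tau1) (fps_mulX (fps_onep (M_meas tau2))) /\
  elt_R_series nu (Zstar * Zvar)
    = fps_comp (R_meas tau2) (fps_mulX (fps_onep (M_meas tau1))).
Proof.
have [mu [_ /eta_diagonal_supported eta_supp mu1 mu2] [_ R_nu]] := hnu.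
have etaE sigma c : (forall n, mu ((if c then Zstar * Zvar else Zvar * Zstar) ^+ n) =
    (moment sigma n)%:C%C) -> eta_meas sigma = alt_coef c (nc_R nu).
  move=> mu_c; rewrite R_nu /nc_eta -alt_coef_eta_series // alt_coef_nc_M.
  by congr eta_series; apply/funext => -[|n] //; rewrite /M_meas /moment_series -mu_c.
have R1 : R_meas tau1 = alt_coef false (nc_R nu).
  by rewrite (proj2 htau1) (etaE _ false).
have R2 : R_meas tau2 = alt_coef true (nc_R nu).
  by rewrite (proj2 htau2) (etaE _ true).
have M_R (tau : probability (measurableTypeR R) R) :
    M_meas tau = fps_comp (R_meas tau) (fps_mulX (fps_onep (M_meas tau))).
  by have [|_ ->] := @R_seriesP _ (M_meas tau).
have nu_supp : alt_supported (nc_R nu) by rewrite R_nu.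
have R_nil c : alt_coef c (nc_R nu) 0%N = 0 by have [] := nc_R_seriesP (nc_M nu).
have N1 := alt_coef_R_series false _ (nc_M_nil nu) nu_supp.
have N2 := alt_coef_R_series true _ (nc_M_nil nu) nu_supp.
rewrite !alt_coef_nc_M /= -/(nc_R nu) in N1 N2.
have T1 := M_R tau1; rewrite R1 in T1.
have T2 := M_R tau2; rewrite R2 in T2.
(* [R_series_two] wants the factor of the series under study first in both equations, so each use
   takes one of them in commuted form. *)
have N1' := N1; rewrite fps_mulC in N1'.
have N2' := N2; rewrite fps_mulC in N2'.
rewrite R1 R2 /elt_R_series; split.
- exact: (R_series_two _ _ _ _ _ (R_nil false) (R_nil true) N1' N2 T2).
- exact: (R_series_two _ _ _ _ _ (R_nil true) (R_nil false) N2' N1 T1).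
Qed.
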